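(* Suppose $\Sigma$ is an ordered alphabet with $|\Sigma|\ge 2$ and $w\in\Sigma^+$. Let $\mathrm{Pn}_r(w)=v_k^{n_k}v_{k-1}^{n_{k-1}}\cdots v_0^{n_0}$ be the rl-Parikh normal form of the word $w$. If $w$ is $\prec$-maximal, then $[\Psi_\Sigma(v_k)]^{n_k}[\Psi_\Sigma(v_{k-1})]^{n_{k-1}}\cdots[\Psi_\Sigma(v_0)]^{n_0}$ is an rl-Parikh normal form of the Parikh matrix $\Psi_\Sigma(w)$.
   Context: **Basic notation.** $\mathbb{N}$ is the set of positive integers. $\Sigma^*$ is the set of words over $\Sigma$, $\lambda$ the empty word, $\Sigma^+=\Sigma^*\setminus\{\lambda\}$, and $|w|$ the length of $w$. An ordered alphabet $\Sigma=\{a_1<a_2<\cdots<a_s\}$ is a finite alphabet with a linear order. **Parikh matrices.** For $n\ge 2$, $\mathcal{M}_n$ is the multiplicative monoid of $n\times n$ upper triangular matrices with nonnegative integer entries and unit diagonal. For $\Sigma=\{a_1<\cdots<a_s\}$, $s\ge 2$, the Parikh matrix mapping $\Psi_\Sigma:\Sigma^*\to\mathcal{M}_{s+1}$ is the monoid morphism with $\Psi_\Sigma(\lambda)=I_{s+1}$ and $\Psi_\Sigma(a_q)$ the matrix with unit diagonal, $(q,q+1)$-entry equal to $1$, and all other entries $0$. Matrices $\Psi_\Sigma(w)$ with $w\in\Sigma^*$ are the Parikh matrices; $\mathcal{P}_\Sigma$ is the set of all of them and $\mathcal{P}_\Sigma^+=\mathcal{P}_\Sigma\setminus\{I_{s+1}\}$.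 Words $w,w'$ are $M$-equivalent if $\Psi_\Sigma(w)=\Psi_\Sigma(w')$; $C_w$ is the $M$-equivalence class of $w$. **rl-Parikh normal forms of matrices.** For $M\in\mathcal{P}_\Sigma^+$: - $\mu(M)=\max\{n\in\mathbb{N} : M=A\cdot B^n \text{ for some } A\in\mathcal{P}_\Sigma,\ B\in\mathcal{P}_\Sigma^+\}$. - $\sigma(M)$ is the sum of the entries of the second diagonal of $M$ (the entries $M_{i,i+1}$). - If $\mu(M)=1$, then $\vartheta(M)$ is the minimum of $\{\sigma(B) : B\in\mathcal{P}_\Sigma^+ \text{ and } M=A\cdot B \text{ for some } A\in\mathcal{P}_\Sigma^+ \text{ with } \mu(A)\neq 1\}$ if this set is nonempty, and $\vartheta(M)=\sigma(M)$ otherwise. - If $\mu(M)>1$, then $\vartheta(M)$ is the maximum of $\{\sigma(B) : B\in\mathcal{P}_\Sigma^+ \text{ and } M=A\cdot B^{\mu(M)} \text{ for some } A\in\mathcal{P}_\Sigma\}$. - $S_M=\{(A,B,\mu(M)) : A\in\mathcal{P}_\Sigma,\ B\in\mathcal{P}_\Sigma^+,\ M=A\cdot B^{\mu(M)},\ \sigma(B)=\vartheta(M)\}$. Let $k\ge 0$ be an integer, and $B_i\in\mathcal{P}_\Sigma$, $n_i\in\mathbb{N}$ for $0\le i\le k$. The formal expression $B_k^{n_k}B_{k-1}^{n_{k-1}}\cdots B_0^{n_0}$ is an rl-Parikh normal form of $M$ iff, setting $A_0=M$, $A_i=B_k^{n_k}\cdots B_i^{n_i}$ for $1\le i\le k$,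 and $A_{k+1}=I_{s+1}$, we have $(A_{i+1},B_i,n_i)\in S_{A_i}$ for all $0\le i\le k$. (It need not be unique.) **rl-Parikh normal form of a word.** For $w\in\Sigma^+$: - $R_w=\{(u,v,n)\in\Sigma^*\times\Sigma^+\times\mathbb{N} : w=uv^n\}$. - $\tau(w)=\max\{n\in\mathbb{N} : (u,v,n)\in R_w \text{ for some } u\in\Sigma^*,\ v\in\Sigma^+\}$. - If $\tau(w)=1$, then $\theta(w)$ is the minimum of $\{|v| : v\in\Sigma^+ \text{ and } w=uv \text{ for some } u\in\Sigma^+ \text{ with } \tau(u)\neq 1\}$ if this set is nonempty, and $\theta(w)=|w|$ otherwise. - If $\tau(w)>1$, then $\theta(w)$ is the maximum of $\{|v| : v\in\Sigma^+ \text{ and } w=uv^{\tau(w)} \text{ for some } u\in\Sigma^*\}$. - $\rho(w)=(u',v',\tau(w))$ is the unique triplet in $R_w$ with third component $\tau(w)$ such that $|v'|=\theta(w)$. - Let $w_0=w$ and recursively, while $w_i\neq\lambda$, $(w_{i+1},v_i,n_i)=\rho(w_i)$. Let $k\ge 0$ be the largest integer with $w_k\neq\lambda$. The formal expression $v_k^{n_k}v_{k-1}^{n_{k-1}}\cdots v_0^{n_0}$ is the rl-Parikh normal form of $w$, denoted $\mathrm{Pn}_r(w)$. **The relation $\prec$.** Let $w,w'$ be distinct $M$-equivalent words with $\mathrm{Pn}_r(w)=v_k^{n_k}\cdots v_0^{n_0}$ and $\mathrm{Pn}_r(w')=y_j^{m_j}\cdots y_0^{m_0}$. Write $w\prec w'$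 iff there is an integer $0\le N\le\min\{j,k\}$ such that 1. $n_i=m_i$ and $v_i=y_i$ for all $0\le i\le N-1$; and 2. one of the following holds: (i) $n_N<m_N$; (ii) $n_N=m_N=1$ and $|v_N|>|y_N|$; (iii) $n_N=m_N>1$ and $|v_N|<|y_N|$. A word $w$ is $\prec$-maximal iff there is no other word $w'\in C_w$ with $w\prec w'$. *)

(* Defs.v *)
From HB Require Import structures.
From mathcomp Require Import all_boot all_order all_algebra.
From mathcomp Require Import boolp classical_sets.

Set Implicit Arguments.
Unset Strict Implicit.
Unset Printing Implicit Defensive.

Local Open Scope classical_set_scope.
Local Open Scope ring_scope.

(* These are 0 when there is no maximum (minimum); every set they are used on
   below is nonempty, and the sets used with max_nat are bounded. *)
Definition max_nat (S : set nat) : nat :=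
  xget 0%N [set n | S n /\ forall m, S m -> (m <= n)%N].

Definition min_nat (S : set nat) : nat :=
  xget 0%N [set n | S n /\ forall m, S m -> (n <= m)%N].

Section ParikhMatrices.
Context {disp : Order.disp_t} {Sigma : finOrderType disp}.

Definition parikh_letter (a : Sigma) : 'M[nat]_(#|Sigma|.+1) :=
  \matrix_(i, j) nat_of_bool ((i == j) ||
    ((i == Order.enum_rank a :> nat) && (j == (Order.enum_rank a).+1 :> nat))).

Definition Psi (w : seq Sigma) : 'M[nat]_(#|Sigma|.+1) :=
  \prod_(a <- w) parikh_letter a.

Definition M_equiv (w w' : seq Sigma) : Prop := Psi w = Psi w'.

End ParikhMatrices.

Section MatrixNormalForm.
Context {disp : Order.disp_t} (Sigma : finOrderType disp).
Local Notation mat := 'M[nat]_(#|Sigma|.+1).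

Definition parikh : set mat := [set M | exists w : seq Sigma, M = Psi w].

Definition parikh_pos : set mat := parikh `\ 1.

Definition mu (M : mat) : nat :=
  max_nat [set n | (0 < n)%N /\
    exists A B, [/\ parikh A, parikh_pos B & M = A * B ^+ n]].

Definition sigma (M : mat) : nat :=
  (\sum_(i < #|Sigma|) M (widen_ord (leqnSn _) i) (lift ord0 i))%N.

Definition vartheta (M : mat) : nat :=
  if mu M == 1%N then
    let S := [set l | exists B, [/\ parikh_pos B,
               exists A, [/\ parikh_pos A, mu A <> 1%N & M = A * B]
             & l = sigma B]] in
    if `[< S !=set0 >] then min_nat S else sigma M
  else
    max_nat [set l | exists B, [/\ parikh_pos B,
               exists A, parikh A /\ M = A * B ^+ mu M
             & l = sigma B]].

Definition S_set (M : mat) : set (mat * mat * nat) :=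
  [set t | let: (A, B, n) := t in
    parikh_pos M /\
    [/\ n = mu M, parikh A, parikh_pos B, M = A * B ^+ n
      & sigma B = vartheta M]].

(* Formal expressions are stored from right to left: the i-th entry of the
   list E is the pair (B_i, n_i), so that E stands for
   B_k ^ n_k ... B_1 ^ n_1 B_0 ^ n_0 with k = (size E).-1. *)
Definition expr_val (E : seq (mat * nat)) : mat :=
  \prod_(p <- rev E) p.1 ^+ p.2.

Definition rl_Parikh_nf (M : mat) (E : seq (mat * nat)) : Prop :=
  let A i := if i == 0%N then M else expr_val (drop i E) in
  [/\ (0 < size E)%N,
      forall p, p \in E -> parikh p.1 /\ (0 < p.2)%N
    & forall i, (i < size E)%N ->
        S_set (A i) (A i.+1, (nth (1, 0%N) E i).1, (nth (1, 0%N) E i).2)].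

End MatrixNormalForm.

Section WordNormalForm.
Context {disp : Order.disp_t} {Sigma : finOrderType disp}.
Local Notation word := (seq Sigma).

Definition wpow (v : word) (n : nat) : word := flatten (nseq n v).

Definition R_set (w : word) : set (word * word * nat) :=
  [set t | let: (u, v, n) := t in
    [/\ v <> [::], (0 < n)%N & w = u ++ wpow v n]].

Definition tau (w : word) : nat :=
  max_nat [set n | exists u v, R_set w (u, v, n)].

Definition theta (w : word) : nat :=
  if tau w == 1%N then
    let S := [set l | exists v, [/\ v <> [::],
               exists u, [/\ u <> [::], tau u <> 1%N & w = u ++ v]
             & l = size v]] in
    if `[< S !=set0 >] then min_nat S else size w
  else
    max_nat [set l | exists v, [/\ v <> [::],
               exists u, w = u ++ wpow v (tau w)
             & l = size v]].

(* t is the triplet rho(w) = (u, v, n); thus t.1.2 is v and t.2 is n. *)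
Definition is_rho (w : word) (t : word * word * nat) : Prop :=
  [/\ R_set w t, t.2 = tau w & size t.1.2 = theta w].

(* rl_nf w F: F is Pn_r(w), stored from right to left as for matrices: the i-th
   entry of F is (v_i, n_i).  The empty word, where the recursion stops, gets
   the empty list. *)
Inductive rl_nf : word -> seq (word * nat) -> Prop :=
| rl_nf_nil : rl_nf [::] [::]
| rl_nf_cons w u v n F :
    w <> [::] -> is_rho w (u, v, n) -> rl_nf u F -> rl_nf w ((v, n) :: F).

Definition prec (w w' : word) : Prop :=
  [/\ w <> w', M_equiv w w' &
    exists F G, [/\ rl_nf w F, rl_nf w' G &
      exists2 N, (N < minn (size F) (size G))%N &
        let n i := (nth ([::], 0%N) F i).2 in
        let v i := (nth ([::], 0%N) F i).1 in
        let m i := (nth ([::], 0%N) G i).2 in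
        let y i := (nth ([::], 0%N) G i).1 in
        (forall i, (i < N)%N -> n i = m i /\ v i = y i) /\
        [\/ (n N < m N)%N,
            [/\ n N = 1%N, m N = 1%N & (size (v N) > size (y N))%N]
          | [/\ n N = m N, (n N > 1)%N & (size (v N) < size (y N))%N]]]].

Definition prec_maximal (w : word) : Prop :=
  ~ exists w', M_equiv w w' /\ prec w w'.

End WordNormalForm.

(* Main.v *)
Require Import Defs.
From mathcomp Require Import all_boot all_order all_algebra.
From mathcomp Require Import boolp classical_sets.
Import GRing.Theory.

(* The second diagonal of [Psi w] sums to [size w], so every factorisation
   [Psi w = A * B ^+ n] lifts to a factorisation [u ++ wpow v n] of a word
   M-equivalent to [w], with [sigma B = size v].  If such a lift did better than
   [w] for [mu] or [vartheta], it would be above [w] for the order, whatever the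
   rest of its normal form; hence [mu] and [vartheta] of [Psi w] are [tau] and
   [theta] of a maximal [w].  Maximality passes from [w = u v^n] to [u]: if
   [u] is below [u'], then either [rho] of [u' v^n] is already larger than
   that of [w], or it is [(u', v, n)] and the comparison of [u] with [u'] is
   merely shifted by one position. *)

(** * Extrema of sets of natural numbers *)

Section Extrema.
Local Open Scope classical_set_scope.

Lemma max_natP (S : set nat) (b : nat) :
  (exists n, S n) -> (forall m, S m -> m <= b) ->
  S (max_nat S) /\ forall m, S m -> m <= max_nat S.
Proof.
move=> [n Sn] ub.
have exS : exists n, `[< S n >] by exists n; apply/asboolP.
have ubS m : `[< S m >] -> m <= b by move/asboolP/ub.
have [m /asboolP Sm le_m] := ex_maxnP exS ubS.
have maxm : [set n | S n /\ forall m, S m -> m <= n] m.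
  by split=> // p /asboolP/le_m.
exact: (xgetPex 0 (ex_intro _ m maxm)).
Qed.

Lemma min_natP (S : set nat) :
  (exists n, S n) -> S (min_nat S) /\ forall m, S m -> min_nat S <= m.
Proof.
move=> [n Sn].
have exS : exists n, `[< S n >] by exists n; apply/asboolP.
have [m /asboolP Sm le_m] := ex_minnP exS.
have minm : [set n | S n /\ forall m, S m -> n <= m] m.
  by split=> // p /asboolP/le_m.
exact: (xgetPex 0 (ex_intro _ m minm)).
Qed.

End Extrema.

(** * Powers of words, [tau], [theta] and [rho] *)

Section Words.
Context {disp : Order.disp_t} {Sigma : finOrderType disp}.
Implicit Types u v w : seq Sigma.

Lemma cat_inj_size u u' v v' :
  size v = size v' -> u ++ v = u' ++ v' -> u = u' /\ v = v'.
Proof.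
move=> szv eq_uv; have /eqP := congr1 size eq_uv.
rewrite !size_cat szv eqn_add2r => /eqP szu.
by have /eqP := eq_uv; rewrite eqseq_cat // => /andP[/eqP -> /eqP ->].
Qed.

Lemma size_wpow v n : size (wpow v n) = n * size v.
Proof. by elim: n => //= n IHn; rewrite size_cat IHn. Qed.

Lemma size_gt0_neq v : v <> [::] -> 0 < size v.
Proof. by case: v. Qed.

Lemma tau_bounded w n : (exists u v, R_set w (u, v, n)) -> n <= size w.
Proof.
move=> [u [v [/size_gt0_neq v0 _ ->]]].
by rewrite size_cat size_wpow (leq_trans _ (leq_addl _ _)) // leq_pmulr.
Qed.

Lemma R_set_triv u v : v <> [::] -> R_set (u ++ v) (u, v, 1).
Proof. by split=> //; rewrite /wpow /= cats0. Qed.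

Lemma tauP w : w <> [::] ->
  (exists u v, R_set w (u, v, tau w)) /\
  forall u v n, R_set w (u, v, n) -> n <= tau w.
Proof.
move=> w0.
have [||Rtau le_tau] := max_natP
  (fun n => exists u v, R_set w (u, v, n)) (size w).
- by exists 1, [::], w; apply: (R_set_triv [::]).
- exact: tau_bounded.
by split=> // u v n Rw; apply: le_tau; exists u, v.
Qed.

(** The defining set is empty here, so [max_nat] returns its default 0. Hence [1 < tau u] already
    forces [u] to be nonempty. *)
Lemma tau_nil : tau ([::] : seq Sigma) = 0.
Proof.
apply: xgetPN => n [[u [v Rw]] _].
case: (Rw) => _ n0 _; suff: n <= 0 by rewrite leqNgt n0.
by apply: (tau_bounded [::]); exists u, v.
Qed.

Lemma tau_gt0 w : w <> [::] -> 0 < tau w.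
Proof. by move=> w0; have [[u [v []]]] := tauP _ w0. Qed.

Lemma tau_neq1 w : w <> [::] -> tau w <> 1 -> 1 < tau w.
Proof. by move=> /tau_gt0; case: (tau w) => [|[]]. Qed.

Lemma tau_gt1_nil w : 1 < tau w -> w <> [::].
Proof. by move=> tw w0; rewrite w0 tau_nil in tw. Qed.

(** The two branches of [theta] when [tau w = 1], with [u <> [::]] and [tau u <> 1] merged into
    [1 < tau u]. *)
Lemma theta1P w : tau w = 1 ->
  (exists u v, [/\ v <> [::], 1 < tau u, w = u ++ v & theta w = size v]) \/
  (theta w = size w /\
   forall u v, v <> [::] -> 1 < tau u -> w <> u ++ v).
Proof.
move=> tw; rewrite /theta tw eqxx /=.
case: asboolP => [/min_natP[]|nS].
  move=> [v [v0 [u [u0 tu wE]] szE]] _; left; exists u, v; split => //.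
  exact: tau_neq1.
right; split=> // u v v0 tu wE; apply: nS; exists (size v), v; split=> //.
by exists u; split=> //; [exact: tau_gt1_nil | move=> t1; rewrite t1 in tu].
Qed.

Lemma theta1_le u v : tau (u ++ v) = 1 -> v <> [::] -> 1 < tau u ->
  theta (u ++ v) <= size v.
Proof.
move=> tw v0 tu; rewrite /theta tw eqxx /=.
have Sv : exists v', [/\ v' <> [::],
    exists u', [/\ u' <> [::], tau u' <> 1 & u ++ v = u' ++ v']
  & size v = size v'].
  exists v; split=> //; exists u.
  by split=> //; [exact: tau_gt1_nil | move=> t1; rewrite t1 in tu].
case: asboolP => [S0|[]]; last by exists (size v).
by have [_] := min_natP _ S0; apply.
Qed.

Lemma theta_gt1P w : 1 < tau w ->
  (exists u v, [/\ v <> [::], w = u ++ wpow v (tau w) & theta w = size v]) /\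
  forall u v, v <> [::] -> w = u ++ wpow v (tau w) -> size v <= theta w.
Proof.
move=> tw; rewrite /theta; case: eqP => [t1|_]; first by rewrite t1 in tw.
have [||[v [v0 [u wE] szE]] le_th] := max_natP (fun l => exists v, [/\ v <> [::],
    exists u, w = u ++ wpow v (tau w) & l = size v]) (size w).
- have [[u [v [v0 _ wE]]] _] := tauP _ (tau_gt1_nil _ tw).
  by exists (size v), v; split=> //; exists u.
- move=> _ [v [_ [u wE] ->]]; rewrite {1}wE size_cat size_wpow.
  by rewrite (leq_trans _ (leq_addl _ _)) // leq_pmull // ltnW.
split=> [|u' v' v'0 w'E]; first by exists u, v.
by apply: le_th; exists v'; split=> //; exists u'.
Qed.

Lemma is_rho_exists w : w <> [::] -> exists t, is_rho w t.
Proof.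
move=> w0; have := tau_gt0 _ w0; rewrite leq_eqVlt => /orP[/eqP t1|t1].
  have [[u [v [v0 tu wE thE]]]|[thE _]] := theta1P _ (esym t1).
    by exists (u, v, 1); split=> //; rewrite wE; apply: R_set_triv.
  by exists ([::], w, 1); split=> //; apply: (R_set_triv [::]).
have [[u [v [v0 wE thE]]] _] := theta_gt1P _ t1.
by exists (u, v, tau w); split=> //; split=> //; apply: ltnW.
Qed.

(** The length of [v] is [theta w], which fixes where [w] is cut. If [theta w] is a minimum, the cut
    is one that attains it; if it is [size w], then [u] would be empty. *)
Lemma is_rho1_tau w u v : is_rho w (u, v, 1) -> u <> [::] -> 1 < tau u.
Proof.
move=> [/= [v0 _ wE] t1 szE] u0; move: wE; rewrite /wpow /= cats0 => wE.
have [[u' [v' [v'0 tu' wE' thE]]]|[thE _]] := theta1P _ (esym t1).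
  by have [||-> _] := @cat_inj_size u u' v v'; rewrite -?wE // szE.
have /eqP := thE; rewrite -szE wE size_cat -{1}[size v]add0n eqn_add2r.
by case: (u) u0.
Qed.

(** * Normal forms of words and the order [prec] *)

Lemma rl_nf_exists w : exists F, rl_nf w F.
Proof.
have [n] := ubnP (size w); elim: n w => // n IHn w szw.
have [->|/eqP w0] := eqVneq w [::]; first by exists [::]; constructor.
have [[[u v] m] rhow] := is_rho_exists _ w0.
have [|F nfF] := IHn u; last first.
  by exists ((v, m) :: F); apply: (rl_nf_cons w0 rhow).
have [[v0 m0 wE] _ _] := rhow.
rewrite ltnS in szw; apply: leq_trans szw.
rewrite wE size_cat size_wpow -{1}[size u]addn0 ltn_add2l muln_gt0 m0.
exact: size_gt0_neq.
Qed.

(* [prec] decided at the rightmost position, N = 0. *)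
Definition rho_lt w w' :=
  [\/ tau w < tau w',
      [/\ tau w = 1, tau w' = 1 & theta w' < theta w]
    | [/\ tau w = tau w', 1 < tau w & theta w < theta w']].

Lemma rho_lt_prec w w' :
  w <> [::] -> w' <> [::] -> M_equiv w w' -> rho_lt w w' -> prec w w'.
Proof.
move=> w0 w'0 eqw lt_w; split=> //.
  by move=> ww'; move: lt_w; rewrite ww' => -[|[_ _]|[_ _]]; rewrite ltnn.
have [[[u v] n] rhow] := is_rho_exists _ w0.
have [[[u' v'] n'] rhow'] := is_rho_exists _ w'0.
have [[F nfF] [F' nfF']] := (rl_nf_exists u, rl_nf_exists u').
exists ((v, n) :: F), ((v', n') :: F').
split; [exact: (rl_nf_cons w0 rhow) | exact: (rl_nf_cons w'0 rhow') |].
exists 0; rewrite ?leq_min //=; split=> //.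
by have [[_ /= -> ->] [_ /= -> ->]] := (rhow, rhow').
Qed.

(** The rightmost exponents are the values of [tau]: they agree when [N > 0], and every alternative
    at [N = 0] leaves the second at least as large. *)
Lemma prec_tau w w' : prec w w' -> tau w <= tau w'.
Proof.
case=> _ _ [F [G [nfF nfG]]].
case: nfF => [|{}w u v n {}F _ rhow _]; first by move=> [N]; rewrite min0n.
case: nfG => [|{}w' u' v' n' {}G _ rhow' _]; first by move=> [N]; rewrite minn0.
have [[_ /= <- _] [_ /= <- _]] := (rhow, rhow').
case=> -[|N] _ /= [eqN cmp]; last by have [/= ->] := eqN 0 isT.
by case: cmp => [/ltnW|[-> ->]|[->]].
Qed.

Lemma M_equiv_cat u u' v : M_equiv u u' -> M_equiv (u ++ v) (u' ++ v).
Proof. by rewrite /M_equiv /Psi !big_cat /= => ->. Qed.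

Lemma prec_rho_cat w u v n u' :
  is_rho w (u, v, n) -> prec u u' -> prec w (u' ++ wpow v n).
Proof.
move=> rhow lt_u; have le_tau := prec_tau _ _ lt_u.
have [[v0 n0 wE] /= tauE thE] := rhow.
have [neq_u equ [F [G [nfF nfG [N ltN cmp]]]]] := lt_u.
(* The empty word has an empty normal form, which leaves no room for [N]. *)
have u0 : u <> [::].
  move=> u0; move: nfF ltN; rewrite u0 => nfF.
  by inversion nfF; subst; rewrite /= ?min0n.
have eqw : M_equiv w (u' ++ wpow v n) by rewrite wE; apply: M_equiv_cat.
have vn0 : wpow v n <> [::].
  move/(congr1 size)/eqP; rewrite size_wpow muln_eq0 eqn0Ngt n0 /=.
  by case: (v) v0.
have w0 : w <> [::] by rewrite wE; case: (u) u0.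
have w'0 : u' ++ wpow v n <> [::] by case: (u').
have Rw' : R_set (u' ++ wpow v n) (u', v, n) by [].
have := (tauP _ w'0).2 _ _ _ Rw'; rewrite leq_eqVlt => /orP[/eqP tauE'|lt_tau];
  last by apply: rho_lt_prec => //; constructor 1; rewrite -tauE.
(* Equality case: [rho] of the new word is [(u', v, n)], so both normal forms gain the same head and
   the deciding position becomes [N.+1]. *)
have rec : theta (u' ++ wpow v n) = size v -> prec w (u' ++ wpow v n).
  move=> thE'; split=> //.
    by rewrite wE => /cat_inj_size[].
  exists ((v, n) :: F), ((v, n) :: G); split.
  - exact: rl_nf_cons nfF.
  - by apply: rl_nf_cons nfG; last split.
  exists N.+1; first by rewrite /= minnSS ltnS.
  move: cmp => [eqN cmp]; split=> //= -[|i] //=; rewrite ltnS; exact: eqN.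
have [n1|n1] := eqVneq n 1.
  (* For [n = 1], [theta] is a minimum over prefixes with [tau] above 1. By [le_tau], [u'] is such a
     prefix, so [theta] can only drop, which [prec] rewards. *)
  have tu : 1 < tau u by apply: (is_rho1_tau w u v); rewrite -?n1.
  have vE : wpow v n = v by rewrite n1 /wpow /= cats0.
  have : theta (u' ++ wpow v n) <= size v.
    rewrite vE; apply: theta1_le => //; last exact: leq_trans le_tau.
    by rewrite -vE -tauE' n1.
  rewrite leq_eqVlt => /orP[/eqP//|lt_th].
  by apply: rho_lt_prec => //; constructor 2; rewrite -?tauE -?tauE' -?thE.
(* For [n > 1], [theta] is a maximum, so it can only grow, which [prec] rewards again. *)
have tw : 1 < tau (u' ++ wpow v n) by rewrite -tauE'; case: (n) n0 n1 => [|[]].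
have := (theta_gt1P _ tw).2 u' v v0; rewrite -tauE' => /(_ erefl).
rewrite leq_eqVlt => /orP[/eqP/esym//|lt_th].
apply: rho_lt_prec => //; constructor 3; rewrite -tauE -tauE' -thE.
by split=> //; rewrite tauE'.
Qed.

End Words.

(** * Parikh matrices, their second diagonal, and [mu] *)

Section Matrices.
Context {disp : Order.disp_t} {Sigma : finOrderType disp}.
Implicit Types u v w : seq Sigma.
Local Notation mat := 'M[nat]_(#|Sigma|.+1).
Implicit Types A B M : mat.
Local Open Scope ring_scope.

Lemma Psi_nil : Psi ([::] : seq Sigma) = 1.
Proof. by rewrite /Psi big_nil. Qed.

Lemma Psi_cat u v : Psi (u ++ v) = Psi u * Psi v.
Proof. by rewrite /Psi big_cat. Qed.

Lemma Psi_wpow v n : Psi (wpow v n) = Psi v ^+ n.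
Proof.
by elim: n => [|n IHn]; rewrite ?Psi_nil ?expr0 // [wpow _ _]/= Psi_cat IHn exprS.
Qed.

(** A letter is sent to an elementary matrix, so left multiplication by it is a row operation. *)
Lemma parikh_letter_mulE (a : Sigma) M i j :
  (parikh_letter a * M) i j =
  (M i j + (i == Order.enum_rank a :> nat) * M (lift ord0 (Order.enum_rank a)) j)%N.
Proof.
rewrite mxE (bigD1 i) //= mxE eqxx /= mul1r; congr (_ + _)%N.
case: eqP => [ia|nia].
  rewrite mul1n (bigD1 (lift ord0 (Order.enum_rank a))) /=; last first.
    apply/eqP => /(congr1 (@nat_of_ord _)); rewrite lift0 ia => /eqP.
    by rewrite eqn_leq ltnn.
  rewrite mxE ia eqxx /= eqxx orbT mul1r big1 ?addr0 // => k /andP[ki ka].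
  rewrite mxE eq_sym (negPf ki) /= ia eqxx /=.
  by case: eqP => [ka'|]; rewrite ?mul0r //; case/eqP: ka; apply: val_inj.
rewrite mul0n big1 // => k ki; rewrite mxE eq_sym (negPf ki) /=.
by move/eqP/negPf: nia => ->; rewrite mul0r.
Qed.

Lemma Psi_unitriangular w (i j : 'I_(#|Sigma|.+1)) :
  (j <= i)%N -> Psi w i j = (i == j) :> nat.
Proof.
elim: w i j => [|a w IHw] i j ji; first by rewrite Psi_nil mxE; case: eqP.
rewrite /Psi big_cons parikh_letter_mulE IHw //.
(* If row [i] receives the next row, the added entry lies strictly below the diagonal, since
   [j <= i], and is 0. *)
have [ia|_] := eqVneq (i : nat) (Order.enum_rank a); last by rewrite mul0n addn0.
rewrite mul1n IHw ?lift0 -?ia ?leqW //.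
have /negPf-> : lift ord0 (Order.enum_rank a) != j; last by rewrite addn0.
apply/eqP => /(congr1 (@nat_of_ord _)); rewrite lift0 -ia => ij.
by rewrite -ij ltnn in ji.
Qed.

(** Prepending a letter of rank q adds row q+1 to row q. On the second diagonal this changes only
    the entry (q, q+1), by the diagonal entry 1. *)
Lemma sigma_Psi w : sigma (Psi w) = size w.
Proof.
elim: w => [|a w IHw] /=.
  rewrite /sigma big1 // => i _; rewrite Psi_nil mxE.
  by case: eqP => // /(congr1 val) /= /eqP; rewrite /bump /= eqn_leq ltnn andbF.
rewrite -IHw /sigma /Psi big_cons -/(Psi w) -[RHS]addn1.
under eq_bigr => i _ do rewrite parikh_letter_mulE.
rewrite big_split /=; congr (_ + _)%N.
rewrite (bigD1 (Order.enum_rank a)) //= eqxx mul1n Psi_unitriangular // eqxx.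
by rewrite big1 // => i /negPf; rewrite -(inj_eq val_inj) /= => ->.
Qed.

Lemma Psi_eq1 w : Psi w = 1 -> w = [::].
Proof. by move=> w1; apply/nilP; rewrite /nilp -sigma_Psi w1 -Psi_nil sigma_Psi. Qed.

Lemma parikh_Psi w : parikh (Psi w). Proof. by exists w. Qed.

Lemma parikh_pos_Psi w : w <> [::] -> parikh_pos (Psi w).
Proof. by move=> w0; split; [apply: parikh_Psi | move/Psi_eq1]. Qed.

Lemma parikh_posP B : parikh_pos B -> exists2 v, v <> [::] & B = Psi v.
Proof. by move=> [[v ->] v1]; exists v => // v0; apply: v1; rewrite v0 Psi_nil. Qed.

Lemma size_M_equiv w w' : M_equiv w w' -> size w = size w'.
Proof. by move=> ww'; rewrite -!sigma_Psi ww'. Qed.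

(** Choosing words for [A] and [B] turns [A * B ^+ n] into a word [u ++ wpow v n] that is
    M-equivalent to [w], hence of the same length. This bounds the exponents by [size w], and
    lifting a factorisation with the largest exponent yields [w']. *)
Lemma muP w : w <> [::] ->
  (exists w', [/\ w' <> [::], M_equiv w w' & (mu (Psi w) <= tau w')%N]) /\
  forall A B n, (0 < n)%N -> parikh A -> parikh_pos B -> Psi w = A * B ^+ n ->
    (n <= mu (Psi w))%N.
Proof.
move=> w0.
have real n A B : (0 < n)%N -> parikh A -> parikh_pos B -> Psi w = A * B ^+ n ->
    exists u v, R_set (u ++ wpow v n) (u, v, n) /\ M_equiv w (u ++ wpow v n).
  move=> n0 [u ->] /parikh_posP[v v0 ->] wE; exists u, v.
  by split; rewrite // /M_equiv Psi_cat Psi_wpow.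
have neq0 w' : M_equiv w w' -> w' <> [::].
  by move=> /size_M_equiv szw w'0; apply: w0; apply: size0nil; rewrite szw w'0.
have [||[mu0 [A [B [pA pB wE]]]] le_mu] := max_natP (fun n => (0 < n)%N /\
    exists A B, [/\ parikh A, parikh_pos B & Psi w = A * B ^+ n]) (size w).
- exists 1; split=> //; exists 1, (Psi w).
  split; [by rewrite -Psi_nil; apply: parikh_Psi | exact: parikh_pos_Psi |].
  by rewrite mul1r.
- move=> n [n0 [A [B [pA pB wE]]]].
  have [u [v [Rw eqw]]] := real _ _ _ n0 pA pB wE.
  by rewrite (size_M_equiv _ _ eqw); apply: tau_bounded; exists u, v.
split.
  have [u [v [Rw eqw]]] := real _ _ _ mu0 pA pB wE; have w'0 := neq0 _ eqw.
  by exists (u ++ wpow v (mu (Psi w))); split=> //; apply: (tauP _ w'0).2 Rw.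
by move=> A' B' n n0 pA' pB' wE'; apply: le_mu; split=> //; exists A', B'.
Qed.

End Matrices.

(** * Comparison of [mu], [vartheta] with [tau], [theta] for maximal words *)

Section Maximal.
Context {disp : Order.disp_t} {Sigma : finOrderType disp}.
Implicit Types u v w : seq Sigma.

Lemma M_equiv_neq0 w w' : w <> [::] -> M_equiv w w' -> w' <> [::].
Proof.
move=> w0 /size_M_equiv szw w'0; apply: w0; apply: size0nil.
by rewrite szw w'0.
Qed.

Lemma maximal_rho_lt w w' :
  w <> [::] -> prec_maximal w -> M_equiv w w' -> ~ rho_lt w w'.
Proof.
move=> w0 maxw eqw lt_w; apply: maxw; exists w'; split=> //.
by apply: rho_lt_prec => //; apply: M_equiv_neq0 eqw.
Qed.

Lemma tau_maximal w w' :
  w <> [::] -> prec_maximal w -> M_equiv w w' -> tau w' <= tau w.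
Proof.
move=> w0 maxw eqw; rewrite leqNgt; apply/negP => lt_tau.
by apply: (maximal_rho_lt w w') => //; constructor 1.
Qed.

Lemma tau_le_mu w : w <> [::] -> tau w <= mu (Psi w).
Proof.
move=> w0; have [[u [v [v0 n0 wE]]] _] := tauP _ w0.
apply: ((muP _ w0).2 (Psi u) (Psi v)) => //.
- exact: parikh_Psi.
- exact: parikh_pos_Psi.
- by rewrite {1}wE Psi_cat Psi_wpow.
Qed.

Lemma mu_maximal w : w <> [::] -> prec_maximal w -> mu (Psi w) = tau w.
Proof.
move=> w0 maxw; apply/eqP; rewrite eqn_leq tau_le_mu // andbT.
have [[w' [_ eqw le_mu]] _] := muP _ w0.
exact: leq_trans le_mu (tau_maximal _ _ w0 maxw eqw).
Qed.

(** [A] is lifted to a word [u'] realising [mu A], so that [1 < tau u']. Maximality forces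
    [tau (u' ++ v) = 1], so [theta (u' ++ v)] is at most [size v]; were [size v] below [theta w],
    the word [u' ++ v] would be above [w]. *)
Lemma theta1_maximal w A B :
  w <> [::] -> prec_maximal w -> tau w = 1 ->
  parikh_pos A -> mu A <> 1 -> parikh_pos B -> Psi w = (A * B)%R ->
  theta w <= sigma B.
Proof.
move=> w0 maxw tw /parikh_posP[u u0 ->] muA /parikh_posP[v v0 ->] wE.
have [[u' [u'0 equ le_mu]] _] := muP _ u0.
have tu' : 1 < tau u'.
  apply: leq_trans le_mu; move: muA (leq_trans (tau_gt0 _ u0) (tau_le_mu _ u0)).
  by case: mu => [|[]].
have eqw : M_equiv w (u' ++ v) by rewrite /M_equiv wE Psi_cat equ.
have tw' : tau (u' ++ v) = 1.
  apply/eqP; rewrite eqn_leq -{1}tw tau_maximal //=.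
  exact: tau_gt0 (M_equiv_neq0 _ _ w0 eqw).
rewrite sigma_Psi (leq_trans _ (theta1_le u' v _ _ _)) // leqNgt.
by apply/negP => lt_th; apply: (maximal_rho_lt _ _ w0 maxw eqw); constructor 2.
Qed.

Lemma theta_gt1_maximal w A B :
  w <> [::] -> prec_maximal w -> 1 < tau w ->
  parikh A -> parikh_pos B -> Psi w = (A * B ^+ tau w)%R ->
  sigma B <= theta w.
Proof.
move=> w0 maxw tw [u ->] /parikh_posP[v v0 ->] wE.
have eqw : M_equiv w (u ++ wpow v (tau w)).
  by rewrite /M_equiv {1}wE Psi_cat Psi_wpow.
have tw' : tau w = tau (u ++ wpow v (tau w)).
  apply/eqP; rewrite eqn_leq (tau_maximal w _ w0 maxw eqw) andbT.
  apply: ((tauP _ (M_equiv_neq0 _ _ w0 eqw)).2 u v).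
  by split=> //; apply: ltnW.
rewrite sigma_Psi; have := tw; rewrite tw' => /theta_gt1P[_ /(_ u v v0)].
rewrite -tw' => /(_ erefl) le_th; apply: leq_trans le_th _; rewrite leqNgt.
by apply/negP => lt_th; apply: (maximal_rho_lt _ _ w0 maxw eqw); constructor 3.
Qed.

Lemma vartheta_maximal w :
  w <> [::] -> prec_maximal w -> vartheta (Psi w) = theta w.
Proof.
move=> w0 maxw; rewrite /vartheta mu_maximal //; case: eqP => [tw|/tau_neq1 tw].
  (* Admissible word factorisations map to admissible matrix ones, as [tau u <= mu (Psi u)]. *)
  have Smem u v : v <> [::] -> 1 < tau u -> w = u ++ v -> exists B, [/\ parikh_pos B,
      exists A, [/\ parikh_pos A, mu A <> 1 & Psi w = (A * B)%R]
    & size v = sigma B].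
    move=> v0 tu wE; have u0 := tau_gt1_nil _ tu; exists (Psi v).
    split; [exact: parikh_pos_Psi | | by rewrite sigma_Psi].
    exists (Psi u); split; [exact: parikh_pos_Psi | | by rewrite wE Psi_cat].
    by move=> muu; have := tau_le_mu _ u0; rewrite muu leqNgt tu.
  set S := (X in min_nat X).
  case: asboolP => [/min_natP[[B [pB [A [pA muA wE]] minE]] le_min]|S0].
    have le_th : theta w <= min_nat S by rewrite minE; apply: theta1_maximal wE.
    apply/eqP; rewrite eqn_leq le_th andbT.
    have [[u [v [v0 tu wuv ->]]]|[-> _]] := theta1P _ tw.
      exact/le_min/(Smem u v).
    (* Here [theta w = size w], which bounds [sigma B] because [B] is a factor of [Psi w]. *)
    rewrite minE -sigma_Psi wE.
    have [[a _ ->] [b _ ->]] := (parikh_posP _ pA, parikh_posP _ pB).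
    by rewrite -Psi_cat !sigma_Psi size_cat leq_addl.
  (* With no admissible matrix factorisation there is no admissible word factorisation, so both
     quantities take their fallback value, the length of [w]. *)
  have [[u [v [v0 tu wuv _]]]|[-> _]] := theta1P _ tw; last by rewrite sigma_Psi.
  by case: S0; exists (size v); apply: (Smem u v).
have {}tw := tw w0.
have [[u [v [v0 wuv thE]]] _] := theta_gt1P _ tw.
have [||[B [pB [A [pA wE]] maxE]] le_max] := max_natP
  (fun l => exists B, [/\ parikh_pos B,
     exists A, parikh A /\ Psi w = (A * B ^+ tau w)%R & l = sigma B]) (theta w).
- exists (theta w), (Psi v); rewrite sigma_Psi thE; split=> //.
    exact: parikh_pos_Psi.
  exists (Psi u); split; first exact: parikh_Psi.
  by rewrite {1}wuv Psi_cat Psi_wpow.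
- by move=> _ [B [pB [A [pA wE]] ->]]; apply: theta_gt1_maximal wE.
apply/eqP; rewrite eqn_leq; apply/andP; split.
  by rewrite maxE; apply: theta_gt1_maximal wE.
apply: le_max; exists (Psi v); rewrite sigma_Psi thE; split=> //.
  exact: parikh_pos_Psi.
exists (Psi u); split; first exact: parikh_Psi.
by rewrite {1}wuv Psi_cat Psi_wpow.
Qed.

Lemma S_set_maximal w u v n :
  w <> [::] -> prec_maximal w -> is_rho w (u, v, n) ->
  S_set (Psi w) (Psi u, Psi v, n).
Proof.
move=> w0 maxw [/= [v0 n0 wE] tauE thE]; split; first exact: parikh_pos_Psi.
split; [by rewrite mu_maximal | exact: parikh_Psi | exact: parikh_pos_Psi | |].
  by rewrite wE Psi_cat Psi_wpow.
by rewrite sigma_Psi vartheta_maximal.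
Qed.

Lemma maximal_rho w u v n :
  prec_maximal w -> is_rho w (u, v, n) -> prec_maximal u.
Proof.
move=> maxw rhow [u' [equ lt_u]]; apply: maxw; exists (u' ++ wpow v n).
split; last exact: prec_rho_cat lt_u.
by have [[_ _ ->] _ _] := rhow; apply: M_equiv_cat.
Qed.

(** * Values of formal expressions and the normal form of the matrix *)

Lemma expr_val_cons (M : 'M[nat]_(#|Sigma|.+1)) n E :
  expr_val ((M, n) :: E) = (expr_val E * M ^+ n)%R.
Proof. by rewrite /expr_val rev_cons -cats1 big_cat big_seq1. Qed.

Lemma expr_val_rl_nf w F :
  rl_nf w F -> expr_val [seq (Psi p.1, p.2) | p <- F] = Psi w.
Proof.
elim=> [|{}w u v n {}F _ [[_ _ ->] _ _] _ IHF] /=.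
  by rewrite /expr_val big_nil Psi_nil.
by rewrite expr_val_cons IHF Psi_cat Psi_wpow.
Qed.

End Maximal.

Theorem theorem5p8 (disp : Order.disp_t) (Sigma : finOrderType disp)
    (hSigma : 2 <= #|Sigma|) (w : seq Sigma) (hw : w <> [::])
    (F : seq (seq Sigma * nat)) (hF : rl_nf w F) (hmax : prec_maximal w) :
  rl_Parikh_nf (Psi w) [seq (Psi p.1, p.2) | p <- F].
Proof.
split.
- by case: hF hw.
- elim: hF => // {hw hmax} {}w u v n {}F _ [[_ n0 _] _ _] _ IHF p.
  rewrite inE => /orP[/eqP -> /=|/IHF //].
  by split=> //; apply: parikh_Psi.
(* The matrix [A 0] is set apart in the definition; writing [Psi w] as the value of the whole
   expression makes all positions uniform. *)
rewrite -(expr_val_rl_nf _ _ hF); set E := map _ F.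
suff step i : i < size E -> S_set (expr_val (drop i E))
    (expr_val (drop i.+1 E), (nth (1%R, 0) E i).1, (nth (1%R, 0) E i).2).
  by case=> [|i] lt_i /=; have := step _ lt_i; rewrite ?drop0.
(* Maximality stays in the induction statement: position 0 uses it for [w], later positions use it
   for the prefix [u]. *)
rewrite {}/E {hw}; elim: hF hmax i => // {}w u v n {}F w0 rhow nfF IHF maxw.
case=> [|i] /= lt_i; last exact: IHF (maximal_rho _ _ _ _ maxw rhow) _ lt_i.
have /= -> := expr_val_rl_nf _ _ (rl_nf_cons w0 rhow nfF).
rewrite drop0 (expr_val_rl_nf _ _ nfF).
exact: (S_set_maximal _ _ _ _ w0 maxw rhow).
Qed.
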